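(* Let $\alpha\in(0,1)$ and $\vartheta\in\Theta$. Let $\varphi_{(n)}$, $n\in\mathbb N$, be step-up-down tests of order $\lambda_n\in\mathbb N_n$ with critical values $\alpha_{i:n}=\rho(i/n)$, $i=1,\dots,n$, for a critical value function $\rho\le f_\alpha^{-1}$, where $\liminf_{n\to\infty}\lambda_n/n>0$. Assume (T1), (T2), (D1), (D2), (D3), (I1), (I2), (A1) (for every $n$), $\lim_{n\to\infty}\zeta_n=\zeta\in[0,1]$, where $\zeta_n=n_0(n)/n$, and $$\forall\varepsilon>0:\quad\liminf_{n\to\infty}\inf_{\varepsilon\le t\le K}\bigl(t-\hat F_n(\rho(t))\bigr)>0\qquad P_\vartheta\text{-almost surely}$$ for some $K\in[0,1]$ fulfilling $K>L=\limsup_{n\to\infty}\lambda_n/n$ in the case $L<1$ and $K=1$ otherwise. Supposing that $\lim_{x\downarrow0}q(x)$ exists, we have $$\lim_{n\to\infty}\mathrm{FDR}_\vartheta(\varphi_{(n)})=\zeta\lim_{x\downarrow0}q(x)=\zeta q(0)=\zeta\overline q(0)\le\zeta\alpha.$$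
   Context: Let $(\mathcal X,\mathcal A,\{P_\vartheta:\vartheta\in\Theta\})$ be a statistical experiment, $(H_i)_{i\in\mathbb N}$ a sequence of null hypotheses with $\varnothing\neq H_i\subset\Theta$, and $(p_i)_{i\in\mathbb N}$ a sequence of $p$-values, i.e. measurable maps $p_i:\mathcal X\to[0,1]$ with $0<P_\vartheta(p_i\le x)\le x$ for all $\vartheta\in H_i$, $i\in\mathbb N$, $x\in(0,1]$. Put $\mathbb N_n=\{1,\dots,n\}$, $I_0(\vartheta)=\{i\in\mathbb N:\vartheta\in H_i\}$, $I_1(\vartheta)=\mathbb N\setminus I_0(\vartheta)$, $I_{n,j}(\vartheta)=I_j(\vartheta)\cap\mathbb N_n$, $n_j(n)=|I_{n,j}(\vartheta)|$, $j=0,1$. $\hat F_n$ is the empirical cumulative distribution function of $p_1,\dots,p_n$, and $p_{1:n}\le\dots\le p_{n:n}$ are the ordered $p$-values. The space is assumed rich enough to carry the following probability measures (not necessarily belonging to $\{P_\vartheta\}$). For $I_0\subseteq\mathbb N$, the Dirac-uniform configuration $P_{I_0}$, under which the $p_i$, $i\in I_0$, are i.i.d. uniform on $[0,1]$ and $p_i=0$ almost surely for $i\notin I_0$. For $\vartheta\in\Theta$ and $i\in I_0(\vartheta)$, a measure $P_{\vartheta^i}$ under which $(p_k)_{k\in\mathbb N}$ has the same distribution as $(p_k^i)_{k\in\mathbb N}$ under $P_\vartheta$, where $p^i_k=p_k$ for $k\ne i$ and $p^i_i\equiv0$. A (non-randomized) multiple test procedure for $H_1,\dots,H_n$ is $\varphi_{(n)}=(\varphi_1,\dots,\varphi_n)$,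 a $\{0,1\}^n$-valued function of $p_1,\dots,p_n$, where $\varphi_i=1$ means that $H_i$ is rejected. $V_n=|\{i\in\mathbb N_n:\varphi_i=1,\ \vartheta\in H_i\}|$, $R_n=|\{i\in\mathbb N_n:\varphi_i=1\}|$, and $\mathrm{FDR}_\vartheta(\varphi_{(n)})=\mathbb E_\vartheta[V_n/(R_n\vee 1)]$. Step-up-down (SUD) test of order $\lambda_n\in\mathbb N_n$ with critical values $0<\alpha_{1:n}\le\dots\le\alpha_{n:n}\le1$: if $p_{\lambda_n:n}\le\alpha_{\lambda_n:n}$, set $m_n=\max\{j\in\{\lambda_n,\dots,n\}:p_{i:n}\le\alpha_{i:n}\text{ for all }i\in\{\lambda_n,\dots,j\}\}$; if $p_{\lambda_n:n}>\alpha_{\lambda_n:n}$, set $m_n=\sup\{j\in\{1,\dots,\lambda_n\}:p_{j:n}\le\alpha_{j:n}\}$ ($\sup\varnothing=-\infty$). Put $\varphi_i=1$ if $p_i\le\alpha_{m_n:n}$ and $\varphi_i=0$ otherwise ($\alpha_{-\infty:n}=-\infty$). A critical value function is a nondecreasing continuous $\rho:[0,1]\to[0,1]$ with $\rho(0)=0$ and $\rho>0$ on $(0,1]$; it does not depend on $n$. Define $q(x)=\rho(x)/x$ for $x\in(0,1]$, $q(0)=\limsup_{x\downarrow0}q(x)$ (finite), and $\overline q(x)=\max_{0\le t\le x}q(t)$, $x\in[0,1]$. Define $f_\alpha^{-1}(t)=\dfrac{\alpha t}{1-(1-\alpha)t}$, $t\in[0,1]$. Conditions: (T1) For all $i\in\mathbb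 N_n$: $p_i\le\alpha_{1:n}$ implies $\varphi_i=1$. (T2) For all $j\in\mathbb N_n$: $R_n=j$ implies that for all $i\in\mathbb N_n$: $\varphi_i=1\Leftrightarrow p_i\le\alpha_{j:n}$. (D1) For all $\vartheta\in\Theta$, $j\in\mathbb N_n$, $i\in I_{n,0}(\vartheta)$: $P_\vartheta(R_n\ge j\mid p_i\le t)$ is nonincreasing in $t\in(0,\alpha_{j:n}]$. (D2) For all $\vartheta\in\Theta$, $j\in\mathbb N_n$, $i\in I_{n,0}(\vartheta)$, $t\in(0,\alpha_{j:n}]$: $P_\vartheta(R_n\ge j\mid p_i\le t)\le P_{\vartheta^i}(R_n\ge j)$. (D3) For all $\vartheta\in\Theta$ and $i\in I_{n,0}(\vartheta)$: $p_i$ is uniformly distributed on $[0,1]$ under $P_\vartheta$. (I1) For all $\vartheta\in\Theta$: the $p_i$, $i\in I_{n,0}(\vartheta)$, are i.i.d. under $P_\vartheta$. (I2) For all $\vartheta\in\Theta$: $(p_i:i\in I_{n,0}(\vartheta))$ and $(p_i:i\in I_{n,1}(\vartheta))$ are stochastically independent random vectors under $P_\vartheta$. (A1) If $(p_1,\dots,p_n)$ is stochastically not greater under $\vartheta_1$ than under $\vartheta_2$, then $\varphi_{(n)}$ is stochastically not greater under $\vartheta_2$ than under $\vartheta_1$. Here $\vartheta_1,\vartheta_2$ range over $\Theta$ and also over the indices of the auxiliary measures $P_{\vartheta^i}$ and $P_{I_0}$ above; ''stochastically not greater'' is the usual multivariate stochastic order (expectations of all nondecreasing functions are ordered whenever they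 exist). *)

(* Defs.v *)
(* MathComp / MathComp-Analysis *)
From HB Require Import structures.
From mathcomp Require Import all_boot all_order all_algebra finmap.
From mathcomp Require Import all_classical all_reals all_analysis.

Set Implicit Arguments.
Unset Strict Implicit.
Unset Printing Implicit Defensive.
Import Order.TTheory GRing.Theory Num.Theory.
Import numFieldNormedType.Exports.
Local Open Scope classical_set_scope.
Local Open Scope ring_scope.

(* Hypotheses and p-values are indexed from 0: H i and p i (i < n) stand for
   H_{i+1} and p_{i+1}.  Ranks, i.e. the index j of a critical value
   alpha_{j:n}, of an order statistic p_{j:n}, or a number of rejections, keep
   their usual range 1, ..., n. *)

(** Probability *)

Definition cond_prob (R : realType) d (X : measurableType d)
    (mu : probability X R) (A B : set X) : R :=
  fine (mu (A `&` B)) / fine (mu B).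

Definition gen_sigma (R : realType) (T : Type) (Y : nat -> T -> R)
    (I : set nat) : set (set T) :=
  <<s [set A | exists2 i, I i &
         exists2 B : set R, measurable B & A = Y i @^-1` B] >>.

Definition indep_family (R : realType) d (X : measurableType d)
    (mu : probability X R) (Y : nat -> X -> R) (I : set nat) : Prop :=
  forall J : {fset nat}, [set` J] `<=` I ->
  forall B : nat -> set R, (forall k, measurable (B k)) ->
    mu (\bigcap_(k in [set` J]) (Y k @^-1` B k)) =
      (\prod_(k <- J) mu (Y k @^-1` B k))%E.

Definition iid (R : realType) d (X : measurableType d)
    (mu : probability X R) (Y : nat -> X -> R) (I : set nat) : Prop :=
  indep_family mu Y I /\
  forall i j, I i -> I j -> forall B : set R, measurable B ->
    mu (Y i @^-1` B) = mu (Y j @^-1` B).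

(* The random vectors (Y i : i in I) and (Y j : j in J) are independent. *)
Definition indep_vectors (R : realType) d (X : measurableType d)
    (mu : probability X R) (Y : nat -> X -> R) (I J : set nat) : Prop :=
  forall A B, gen_sigma Y I A -> gen_sigma Y J B ->
    mu (A `&` B) = (mu A * mu B)%E.

Definition uniform01 (R : realType) d (X : measurableType d)
    (mu : probability X R) (Y : X -> R) : Prop :=
  forall B : set R, measurable B ->
    mu (Y @^-1` B) = uniform_prob (@ltr01 R) B.

(* Equality of laws on R^nat with the product sigma-algebra. *)
Definition same_law (R : realType) d (X : measurableType d)
    (mu1 mu2 : probability X R) (Y1 Y2 : nat -> X -> R) : Prop :=
  forall A, gen_sigma (fun (k : nat) (u : nat -> R) => u k) setT A ->
    mu1 [set x | A (fun k => Y1 k x)] = mu2 [set x | A (fun k => Y2 k x)].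

(* Y is stochastically not greater under mu1 than under mu2, in the
   multivariate stochastic order. *)
Definition st_le (R : realType) d (X : measurableType d) n
    (mu1 mu2 : probability X R) (Y : X -> n.-tuple R) : Prop :=
  forall f : n.-tuple R -> R,
    measurable_fun setT f ->
    (forall u v : n.-tuple R,
        (forall i, tnth u i <= tnth v i) -> f u <= f v) ->
    mu1.-integrable setT (EFin \o (f \o Y)) ->
    mu2.-integrable setT (EFin \o (f \o Y)) ->
    ('E_mu1[f \o Y] <= 'E_mu2[f \o Y])%E.

(** Hypotheses and p-values *)

Definition pvalue (R : realType) d (X : measurableType d) (Theta : Type)
    (P : Theta -> probability X R) (Hi : set Theta) (pi : {mfun X >-> R})
    : Prop :=
  (forall x, 0 <= pi x <= 1) /\
  forall th, Hi th -> forall t : R, 0 < t <= 1 ->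
    (0 < P th [set x | (pi x <= t)%R] <= t%:E)%E.

Definition I0 (Theta : Type) (H : nat -> set Theta) (th : Theta) : set nat :=
  [set i | H i th].

Definition In0 (Theta : Type) (H : nat -> set Theta) (n : nat) (th : Theta)
    : set nat := [set i | (i < n)%N /\ H i th].

Definition In1 (Theta : Type) (H : nat -> set Theta) (n : nat) (th : Theta)
    : set nat := [set i | (i < n)%N /\ ~ H i th].

Definition n0 (Theta : Type) (H : nat -> set Theta) (th : Theta) (n : nat)
    : nat := #|[pred i : 'I_n | th \in H i]|.

Definition pvec (R : realType) d (X : measurableType d)
    (p : nat -> {mfun X >-> R}) n (x : X) : n.-tuple R :=
  [tuple p i x | i < n].

Definition Fhat (R : realType) n (u : n.-tuple R) (t : R) : R :=
  #|[pred i : 'I_n | tnth u i <= t]|%:R / n%:R.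

Definition zeroed (R : realType) d (X : measurableType d)
    (p : nat -> {mfun X >-> R}) (i k : nat) (x : X) : R :=
  if k == i then 0 else p k x.

Definition dirac_uniform (R : realType) d (X : measurableType d)
    (mu : probability X R) (p : nat -> {mfun X >-> R}) (J : set nat) : Prop :=
  [/\ indep_family mu p J,
      forall i, J i -> uniform01 mu (p i) &
      forall i, ~ J i -> {ae mu, forall x, p i x = 0}].

(** Multiple tests *)

Definition mtest (R : realType) (n : nat) : Type := n.-tuple R -> 'I_n -> bool.

Definition Rnum (R : realType) n (phi : mtest R n) (u : n.-tuple R) : nat :=
  #|[pred i : 'I_n | phi u i]|.

Definition Vnum (R : realType) (Theta : Type) (H : nat -> set Theta)
    (th : Theta) n (phi : mtest R n) (u : n.-tuple R) : nat :=
  #|[pred i : 'I_n | phi u i && (th \in H i)]|.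

Definition FDR (R : realType) d (X : measurableType d) (Theta : Type)
    (P : Theta -> probability X R) (H : nat -> set Theta)
    (p : nat -> {mfun X >-> R}) (th : Theta) n (phi : mtest R n) : \bar R :=
  ('E_(P th)[fun x => ((Vnum H th phi (pvec p n x))%:R /
                       (maxn (Rnum phi (pvec p n x)) 1)%:R)%R])%E.

Definition ordstat (R : realType) n (u : n.-tuple R) (j : nat) : R :=
  nth 0 (sort <=%R u) j.-1.

(* Threshold index of the step-up-down test; the value 0 encodes the supremum
   -oo of the empty set (admissible indices are at least 1). *)
Definition sud_index (R : realType) n (lam : nat) (a : nat -> R)
    (u : n.-tuple R) : nat :=
  if ordstat u lam <= a lam then
    \max_(j < n.+1 | (lam <= j)%N &&
            [forall i : 'I_n.+1, (lam <= i <= j)%N ==> (ordstat u i <= a i)]) j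
  else \max_(j < n.+1 | (1 <= j <= lam)%N && (ordstat u j <= a j)) j.

Definition sud_test (R : realType) n (lam : nat) (a : nat -> R) : mtest R n :=
  fun u i => (0 < sud_index lam a u)%N && (tnth u i <= a (sud_index lam a u)).

(** Critical value functions *)

Definition critical_value_function (R : realType) (rho : R -> R) : Prop :=
  [/\ (forall t, t \in `[0, 1] -> rho t \in `[0, 1]),
      {in `[0, 1] &, {homo rho : s t / s <= t}},
      {within `[0, 1], continuous rho},
      rho 0 = 0 &
      forall t, 0 < t <= 1 -> 0 < rho t].

Definition crit (R : realType) (rho : R -> R) (n j : nat) : R :=
  rho (j%:R / n%:R).

(* The limsup at 0 is taken in \bar R; it is finite whenever
   rho <= f_alpha_inv alpha, so that fine loses nothing there. *)
Definition q (R : realType) (rho : R -> R) (x : R) : R :=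
  if x == 0 then fine (limf_esup (fun t => (rho t / t)%:E) (0 : R)^'+)
  else rho x / x.

(* The maximum is attained: q is continuous on (0,1] and upper semicontinuous
   at 0. *)
Definition qbar (R : realType) (rho : R -> R) (x : R) : R :=
  sup (q rho @` `[0, x]).

Definition f_alpha_inv (R : realType) (alpha t : R) : R :=
  alpha * t / (1 - (1 - alpha) * t).

(** Conditions on a test phi of H 0, ..., H (n-1) with critical values a *)

Definition condT1 (R : realType) d (X : measurableType d)
    (p : nat -> {mfun X >-> R}) n (a : nat -> R) (phi : mtest R n) : Prop :=
  forall (x : X) (i : 'I_n), p i x <= a 1%N -> phi (pvec p n x) i.

Definition condT2 (R : realType) d (X : measurableType d)
    (p : nat -> {mfun X >-> R}) n (a : nat -> R) (phi : mtest R n) : Prop :=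
  forall (x : X) (j : nat), (1 <= j <= n)%N -> Rnum phi (pvec p n x) = j ->
  forall i : 'I_n, phi (pvec p n x) i <-> p i x <= a j.

Definition condD1 (R : realType) d (X : measurableType d) (Theta : Type)
    (P : Theta -> probability X R) (H : nat -> set Theta)
    (p : nat -> {mfun X >-> R}) n (a : nat -> R) (phi : mtest R n) : Prop :=
  forall (th : Theta) (j i : nat), (1 <= j <= n)%N -> In0 H n th i ->
  forall s t : R, 0 < s -> s <= t -> t <= a j ->
    cond_prob (P th) [set x | (j <= Rnum phi (pvec p n x))%N]
                    [set x | p i x <= t]
    <= cond_prob (P th) [set x | (j <= Rnum phi (pvec p n x))%N]
                       [set x | p i x <= s].

Definition condD2 (R : realType) d (X : measurableType d) (Theta : Type)
    (P : Theta -> probability X R) (Pz : Theta -> nat -> probability X R)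
    (H : nat -> set Theta) (p : nat -> {mfun X >-> R})
    n (a : nat -> R) (phi : mtest R n) : Prop :=
  forall (th : Theta) (j i : nat), (1 <= j <= n)%N -> In0 H n th i ->
  forall t : R, 0 < t -> t <= a j ->
    cond_prob (P th) [set x | (j <= Rnum phi (pvec p n x))%N]
                    [set x | p i x <= t]
    <= fine (Pz th i [set x | (j <= Rnum phi (pvec p n x))%N]).

Definition condD3 (R : realType) d (X : measurableType d) (Theta : Type)
    (P : Theta -> probability X R) (H : nat -> set Theta)
    (p : nat -> {mfun X >-> R}) (n : nat) : Prop :=
  forall (th : Theta) (i : nat), In0 H n th i -> uniform01 (P th) (p i).

Definition condI1 (R : realType) d (X : measurableType d) (Theta : Type)
    (P : Theta -> probability X R) (H : nat -> set Theta)
    (p : nat -> {mfun X >-> R}) (n : nat) : Prop :=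
  forall th : Theta, iid (P th) p (In0 H n th).

Definition condI2 (R : realType) d (X : measurableType d) (Theta : Type)
    (P : Theta -> probability X R) (H : nat -> set Theta)
    (p : nat -> {mfun X >-> R}) (n : nat) : Prop :=
  forall th : Theta, indep_vectors (P th) p (In0 H n th) (In1 H n th).

Definition model_measures (R : realType) d (X : measurableType d)
    (Theta : Type) (P : Theta -> probability X R)
    (Pz : Theta -> nat -> probability X R) (PDU : set nat -> probability X R)
    (H : nat -> set Theta) : set (probability X R) :=
  [set mu | [\/ exists th, mu = P th,
                exists th i, I0 H th i /\ mu = Pz th i |
                exists J, mu = PDU J]].

Definition condA1 (R : realType) d (X : measurableType d) (Theta : Type)
    (P : Theta -> probability X R) (Pz : Theta -> nat -> probability X R)
    (PDU : set nat -> probability X R) (H : nat -> set Theta)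
    (p : nat -> {mfun X >-> R}) n (phi : mtest R n) : Prop :=
  forall mu1 mu2 : probability X R,
    model_measures P Pz PDU H mu1 -> model_measures P Pz PDU H mu2 ->
    st_le mu1 mu2 (pvec p n) ->
    st_le mu2 mu1 (fun x => [tuple (phi (pvec p n x) i)%:R | i < n]).

(* Main.v *)
Require Import Defs.
From HB Require Import structures.
From mathcomp Require Import all_boot all_order all_algebra finmap.
From mathcomp Require Import all_classical all_reals all_analysis.
From mathcomp Require Import measurable_realfun lra.

Set Implicit Arguments.
Unset Strict Implicit.
Unset Printing Implicit Defensive.
Import Order.TTheory GRing.Theory Num.Theory.
Import numFieldNormedType.Exports.
Local Open Scope classical_set_scope.
Local Open Scope ring_scope.

(** Why the limit is zeta * q(0).  The gap condition says that, away from 0, the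
points (j/n, F_n(rho(j/n))) of the empirical distribution function stay
uniformly below the diagonal; equivalently, the number of p-values at or below
the j-th critical value a j = rho(j/n) is less than j, with a margin of
order n, for all j between eps * n and K * n.  Since lambda_n / n stays in this
range, the test starts its search at a rank where the threshold is missed, moves
down, and rejects fewer than eps * n hypotheses.

For a true null i, let p^i be the p-values with p_i replaced by 0.  This raises
each count by at most one, so that the margin absorbs the change and the whole
picture also holds for p^i, simultaneously for all i, outside an event
[near_crossing] whose probability tends to 0.  Let r be the index selected by
the step-up procedure, capped at lambda_n, from p^i.  A step-up index is self
consistent: hypothesis i is rejected on the basis of p exactly when p_i <= a r,
and then exactly r hypotheses are rejected ([rejection_zero_coord]).  Hence the
contribution of i to the false discovery proportion is 1{p_i <= a r} / r.

As r is a function of the p-values other than p_i, it is independent of p_i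
([zero_coord_indep]), and p_i is uniform; therefore the expected contribution of
i is that of a r / r = q(r/n) / n with r < eps * n.  Summation over the n_0
true nulls squeezes the false discovery rate between (n_0/n) times lower and
upper bounds of q on (0, eps), up to the probability of [near_crossing]
([FDR_bounds]).  Letting n tend to infinity and then eps to 0 gives the limit
([FDR_limit]). *)

(** * The step-up-down test in terms of counts *)

Definition below (R : realType) n (u : n.-tuple R) (t : R) : nat :=
  #|[pred k : 'I_n | tnth u k <= t]|.

Definition zero_coord (R : realType) n (i : 'I_n) (u : n.-tuple R) :
    n.-tuple R :=
  [tuple if k == i then 0 else tnth u k | k < n].

(** The step-up index capped at [lam]; the value 0 stands for an empty maximum. *)
Definition su_index (R : realType) n (lam : nat) (a : nat -> R)
    (u : n.-tuple R) : nat :=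
  \max_(j < n.+1 | (1 <= j <= lam)%N && (j <= below u (a j))%N) j.

(** For the set [C] of all ranks of size at least eps * n, this keeps the capped
step-up index below eps * n. *)
Definition no_crossing (R : realType) n (lam : nat) (a : nat -> R)
    (C : pred nat) (u : n.-tuple R) : bool :=
  [forall j : 'I_n.+1, [&& (1 <= j)%N, (j <= lam)%N & C j] ==>
     (below u (a j) < j)%N].

Section Combinatorics.
Context (R : realType) (n : nat).
Implicit Types (u v : n.-tuple R) (a : nat -> R) (i : 'I_n).

Lemma below_count u t : below u t = count (<= t) u.
Proof.
rewrite /below -sum1_card -sum1_count big_mkcond /=.
by rewrite big_tuple [RHS]big_mkcond.
Qed.

(** The counts determine the comparisons of order statistics with thresholds, so
that sorting disappears from all that follows. *)
Lemma ordstat_leE u j t : (1 <= j <= n)%N ->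
  (ordstat u j <= t) = (j <= below u t)%N.
Proof.
case: j => [//|j] /= jn; rewrite /ordstat /= below_count.
have su : sorted <=%O (sort <=%R u) by exact: sort_le_sorted.
have cu : count (<= t) (sort <=%R u) = count (<= t) u by rewrite count_sort.
apply/idP/idP => [h|h]; last by apply: nth_count_le => //; rewrite cu.
rewrite ltnNge; apply/negP => le; move: h; apply/negP; rewrite -ltNge.
by apply: nth_count_gt => //; rewrite cu le size_sort size_tuple.
Qed.

Lemma below_le u s t : s <= t -> (below u s <= below u t)%N.
Proof.
move=> st; apply: subset_leq_card; apply/fintype.subsetP => k; rewrite !inE.
by move=> /le_trans; apply.
Qed.

Lemma su_index_le lam a u : (su_index lam a u <= lam)%N.
Proof. by apply/bigmax_leqP => j /andP[/andP[]]. Qed.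

Lemma su_index_leq lam a u j : (lam <= n)%N -> (1 <= j <= lam)%N ->
  (j <= below u (a j))%N -> (j <= su_index lam a u)%N.
Proof.
move=> ln jl jb; have jn : (j < n.+1)%N.
  by rewrite ltnS; case/andP: jl => _ /leq_trans; apply.
by rewrite (@leq_bigmax_cond _ _ _ (Ordinal jn)) //= jl.
Qed.

Lemma su_index_below lam a u : (0 < su_index lam a u)%N ->
  (su_index lam a u <= below u (a (su_index lam a u)))%N.
Proof.
pose Q (j : 'I_n.+1) := (1 <= j <= lam)%N && (j <= below u (a j))%N.
rewrite /su_index -/Q; have [j Qj|Q0] := pickP Q; last by rewrite big_pred0.
have Q0 : (0 < #|Q|)%N by apply/card_gt0P; exists j.
by have [k /andP[_ kb] ->] := eq_bigmax_cond (@nat_of_ord n.+1) Q0.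
Qed.

Lemma su_index_eq lam a u m : (lam <= n)%N -> (1 <= m <= lam)%N ->
  (m <= below u (a m))%N ->
  (forall j, (m < j <= lam)%N -> (below u (a j) < j)%N) ->
  su_index lam a u = m.
Proof.
move=> ln ml mb h; apply/eqP; rewrite eqn_leq su_index_leq// andbT leqNgt.
apply/negP => lt; have := h (su_index lam a u).
rewrite lt su_index_le => /(_ isT); rewrite ltnNge su_index_below//.
by rewrite (leq_ltn_trans _ lt).
Qed.

Lemma su_index_gt lam a u j : (lam <= n)%N -> (su_index lam a u < j <= lam)%N ->
  (below u (a j) < j)%N.
Proof.
move=> ln /andP[mj jl]; rewrite ltnNge; apply/negP => h.
by have := mj; rewrite ltnNge su_index_leq// jl andbT (leq_trans _ mj).
Qed.

(** Once the count at rank [lam] misses the threshold, the step-up-down test takes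
its downward branch. *)
Lemma sud_index_su lam a u : (1 <= lam <= n)%N -> (below u (a lam) < lam)%N ->
  sud_index lam a u = su_index lam a u.
Proof.
move=> ln bl; rewrite /sud_index ordstat_leE// leqNgt bl /=.
apply: eq_bigl => j; case jl: (1 <= j <= lam)%N => //=; rewrite ordstat_leE//.
by case/andP: jl => -> /= /leq_trans; apply; case/andP: ln.
Qed.

Lemma tnth_zero_coord i u k :
  tnth (zero_coord i u) k = if k == i then 0 else tnth u k.
Proof. by rewrite tnth_mktuple. Qed.

Lemma below_zero_coord i u t : 0 <= t ->
  (below u t <= below (zero_coord i u) t)%N.
Proof.
move=> t0; apply: subset_leq_card; apply/fintype.subsetP => k.
by rewrite !inE tnth_zero_coord; case: eqP => // _.
Qed.

(** A coordinate that is already below the threshold can be lowered to 0 without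
being noticed; this is the reason why step-up indices are self consistent. *)
Lemma below_zero_coord_eq i u t : 0 <= t -> tnth u i <= t ->
  below (zero_coord i u) t = below u t.
Proof.
move=> t0 ut; apply: eq_card => k.
by rewrite !inE tnth_zero_coord; case: eqP => // ->; rewrite t0 ut.
Qed.

Lemma below_zero_coordS i u t : (below (zero_coord i u) t <= (below u t).+1)%N.
Proof.
rewrite /below.
apply: (@leq_trans #|[predU1 i & [pred k : 'I_n | tnth u k <= t]]|).
  apply: subset_leq_card; apply/fintype.subsetP => k.
  by rewrite !inE tnth_zero_coord; case: eqP.
by rewrite cardU1 -addn1 addnC leq_add2l leq_b1.
Qed.

Lemma no_crossingP lam a (C : pred nat) u : (lam <= n)%N ->
  reflect (forall j, (1 <= j <= lam)%N -> C j -> (below u (a j) < j)%N)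
    (no_crossing lam a C u).
Proof.
move=> ln; apply: (iffP forallP) => h j.
  move=> /andP[j1 jl] Cj; have jn : (j < n.+1)%N by rewrite ltnS (leq_trans jl).
  by have /implyP := h (Ordinal jn); rewrite /= j1 jl Cj => /(_ isT).
by apply/implyP => /and3P[j1 jl Cj]; apply: h; rewrite ?j1.
Qed.

Section Rejection.
Context (lam : nat) (a : nat -> R) (C : pred nat).
Hypotheses (lam_range : (1 <= lam <= n)%N) (C_lam : C lam).
Hypothesis a_ge0 : forall j, (j <= n)%N -> 0 <= a j.
Hypothesis a_le : forall j k, (j <= k <= n)%N -> a j <= a k.

Let lamn : (lam <= n)%N. Proof. by case/andP: lam_range. Qed.
Let lam1 : (1 <= lam)%N. Proof. by case/andP: lam_range. Qed.

Lemma su_index_no_crossing u : no_crossing lam a C u ->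
  (su_index lam a u < lam)%N.
Proof.
move=> /(no_crossingP _ _ _ lamn)/(_ lam).
rewrite lam1 leqnn => /(_ isT C_lam) bl.
rewrite ltn_neqAle su_index_le andbT; apply/eqP => e.
by have := @su_index_below lam a u; rewrite e lam1 leqNgt bl => /(_ isT).
Qed.

Lemma su_index_zero_coord_gt0 i u : (0 < su_index lam a (zero_coord i u))%N.
Proof.
apply: su_index_leq; rewrite ?lam1//.
apply/card_gt0P; exists i; rewrite inE tnth_zero_coord eqxx.
by rewrite a_ge0// (leq_trans lam1).
Qed.

(** The count at rank m + 1 is at most m by maximality, and the count at rank m is
at least m; monotonicity of the thresholds forces both to equal m. *)
Lemma Rnum_sud u : (below u (a lam) < lam)%N -> (0 < sud_index lam a u)%N ->
  Rnum (sud_test lam a) u = sud_index lam a u.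
Proof.
move=> bl m0; have e := sud_index_su lam_range bl.
have -> : Rnum (sud_test lam a) u = below u (a (sud_index lam a u)).
  by apply: eq_card => k; rewrite !inE /sud_test m0.
rewrite e in m0 *; set m := su_index lam a u in m0 *.
apply/eqP; rewrite eqn_leq su_index_below// andbT.
have ml : (m < lam)%N.
  rewrite ltn_neqAle su_index_le andbT; apply/eqP => em.
  by have := su_index_below m0; rewrite -/m em leqNgt bl.
have mS : (below u (a m.+1) < m.+1)%N.
  by apply: (su_index_gt (lam := lam) lamn); rewrite -/m ltnSn.
by rewrite -ltnS (leq_ltn_trans _ mS)// below_le// a_le// leqnSn (leq_trans ml).
Qed.

(** The procedure applied to [u] and to [zero_coord i u] sees the same counts at all
ranks whose threshold is at least [tnth u i].  If hypothesis [i] is rejected,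
these are all ranks from the selected index on, whence both procedures select
the same index; conversely, if [tnth u i] is below the threshold selected from
[zero_coord i u], then that index is selected from [u] as well. *)
Lemma rejection_zero_coord i u : no_crossing lam a C (zero_coord i u) ->
  (sud_test lam a u i)%:R / (maxn (Rnum (sud_test lam a) u) 1)%:R =
  (tnth u i <= a (su_index lam a (zero_coord i u)))%R%:R /
    (su_index lam a (zero_coord i u))%:R :> R.
Proof.
move=> nc; set v := zero_coord i u in nc *; set r := su_index lam a v.
have r0 : (0 < r)%N := su_index_zero_coord_gt0 i u.
have rl : (r < lam)%N := su_index_no_crossing nc.
(* Zeroing a coordinate only raises counts, so [u] misses rank lam too. *)
have bl : (below u (a lam) < lam)%N.
  apply: leq_ltn_trans (no_crossingP _ _ _ lamn nc lam _ C_lam).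
    by apply: below_zero_coord; exact: a_ge0.
  by rewrite lam1 leqnn.
have e := sud_index_su lam_range bl.
case ur: (tnth u i <= a r).
  have ru : sud_index lam a u = r.
    rewrite e; apply: su_index_eq => //.
    - by rewrite r0 ltnW.
    - rewrite -(@below_zero_coord_eq i)//; last exact/a_ge0/(leq_trans (ltnW rl)).
      exact: (su_index_below r0).
    - move=> j /[dup] rjl /andP[rj jl]; have jn := leq_trans jl lamn.
      apply: leq_ltn_trans (su_index_gt lamn rjl).
      by apply: below_zero_coord; exact: a_ge0.
  rewrite Rnum_sud ?ru //.
  by rewrite /sud_test ru r0 ur (maxn_idPl r0).
case su: (sud_test lam a u i); last by rewrite !mul0r.
move: su ur; rewrite /sud_test => /andP[m0 um] /negP; case.
suff -> : r = sud_index lam a u by [].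
rewrite e in m0 um *; set m := su_index lam a u in m0 um *.
have ml : (m <= lam)%N := su_index_le _ _ _.
apply: su_index_eq => //; first by rewrite m0.
  rewrite below_zero_coord_eq//; first exact: (su_index_below m0).
  exact/a_ge0/(leq_trans ml).
move=> j /[dup] mjl /andP[mj jl]; have jn := leq_trans jl lamn.
rewrite below_zero_coord_eq; [exact: (su_index_gt lamn mjl)|exact: a_ge0|].
by apply: le_trans um (a_le _); rewrite ltnW.
Qed.

End Rejection.
End Combinatorics.

(** * Independence of a null p-value from the others *)

Lemma measurable_le_threshold (R : realType) (t : R) :
  measurable [set r : R | r <= t].
Proof.
rewrite (_ : [set _ | _] = [set` `]-oo, t]]); first exact: measurable_itv.
by apply/seteqP; split => r; rewrite /= in_itv.
Qed.

Section FiniteValued.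
Context (R : realType) (d : measure_display) (X : measurableType d).
Context (mu : probability X R) (T : finType) (W : X -> T).
Hypothesis mW : forall g, measurable (W @^-1` [set g]).

Lemma fin_preimageE (A : set T) :
  W @^-1` A = \bigcup_(g in A) W @^-1` [set g].
Proof.
apply/seteqP; split => [x Ax|x [g Ag /= e]]; first by exists (W x).
by rewrite /preimage /= e.
Qed.

Lemma fin_preimage_measurable (A : set T) : measurable (W @^-1` A).
Proof.
rewrite fin_preimageE; apply: fin_bigcup_measurable.
  exact: finite_finset.
by [].
Qed.

Lemma saturated_preimage (A : set X) :
  (forall x y, W x = W y -> A x -> A y) -> A = W @^-1` (W @` A).
Proof.
move=> sat; apply/seteqP; split => [x Ax|x [y Ay /sat]]; first by exists x.
exact.
Qed.

Lemma saturated_measurable (A : set X) :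
  (forall x y, W x = W y -> A x -> A y) -> measurable A.
Proof. by move=> /saturated_preimage ->; exact: fin_preimage_measurable. Qed.

Lemma saturated_measurable_fun (f : X -> R) :
  (forall x y, W x = W y -> f x = f y) -> measurable_fun setT f.
Proof.
move=> sat _ Y _; rewrite setTI; apply: saturated_measurable => x y /sat.
by rewrite /preimage /= => ->.
Qed.

Lemma measure_fin_preimageI (A : set T) (D : set X) : measurable D ->
  mu (W @^-1` A `&` D) = (\sum_(g \in A) mu (W @^-1` [set g] `&` D))%E.
Proof.
move=> mD; rewrite fin_preimageE setI_bigcupl measure_fin_bigcup//.
- exact: finite_finset.
- by move=> g h _ _ [x [[/= <- _] [/= <- _]]].
- by move=> g _; apply: measurableI.
Qed.

(** Events that depend on an experiment with finitely many outcomes split into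
finitely many fibers, so that independence needs to be checked on fibers only;
this replaces a monotone class argument. *)
Lemma saturated_independent (A D : set X) : measurable D ->
  (forall g, mu (W @^-1` [set g] `&` D) = mu (W @^-1` [set g]) * mu D)%E ->
  (forall x y, W x = W y -> A x -> A y) ->
  mu (A `&` D) = (mu A * mu D)%E.
Proof.
move=> mD ind /saturated_preimage ->; rewrite measure_fin_preimageI//.
rewrite -[in RHS](setIT (W @^-1` _)) measure_fin_preimageI// ge0_mule_fsuml//.
by apply: eq_fsbigr => g _; rewrite setIT.
Qed.

End FiniteValued.

Section Independence.
Context (R : realType) (d : measure_display) (X : measurableType d).
Context (mu : probability X R) (p : nat -> {mfun X >-> R}).

Lemma gen_sigma_bigcap (I : set nat) (B : nat -> set R) :
  (forall k, measurable (B k)) ->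
  gen_sigma p I (\bigcap_(k in I) p k @^-1` B k).
Proof.
move=> mB; rewrite /gen_sigma; set G := [set A | _].
apply: (@bigcap_measurableType _ (g_sigma_algebraType G)) => k Ik.
by apply: sub_sigma_algebra; exists k => //; exists (B k).
Qed.

Lemma indep_family_remove (I : set nat) i (B : nat -> set R) (C : set R) :
  finite_set I -> I i -> indep_family mu p I ->
  (forall k, measurable (B k)) -> measurable C ->
  mu (\bigcap_(k in I) p k @^-1` (if k == i then C else B k)) =
  (mu (p i @^-1` C) *
   mu (\bigcap_(k in I) p k @^-1` (if k == i then setT else B k)))%E.
Proof.
move=> finI Ii ind mB mC.
have iI : i \in fset_set I by rewrite in_fset_set// inE.
have fact D : measurable D ->
    mu (\bigcap_(k in I) p k @^-1` (if k == i then D else B k)) =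
    (mu (p i @^-1` D) * \prod_(k <- (fset_set I `\ i)%fset) mu (p k @^-1` B k))%E.
  move=> mD; have := ind (fset_set I) _ (fun k => if k == i then D else B k).
  rewrite fset_setK// => ->; [|exact: subset_refl|by move=> k; case: ifP].
  rewrite (big_fsetD1 i)//= eqxx; congr (_ * _)%E.
  rewrite !big_seq; apply: eq_bigr => k; rewrite in_fsetD1 => /andP[/negPf -> _].
  by [].
by rewrite !fact// preimage_setT probability_setT mul1e.
Qed.

Context (Theta : Type) (H : nat -> set Theta) (th : Theta) (n : nat).
Hypothesis indep_null : indep_family mu p (In0 H n th).
Hypothesis indep_null_alt : indep_vectors mu p (In0 H n th) (In1 H n th).

(** The rectangle splits into a part over the true nulls and a part over the
alternatives.  Vector independence separates the two parts, and independence
within the nulls detaches coordinate [i] from the first one. *)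
Lemma rectangle_indep (i : nat) (B : nat -> set R) (C : set R) :
  In0 H n th i -> (forall k, measurable (B k)) -> measurable C ->
  mu (\bigcap_(k in [set k | (k < n)%N /\ k <> i]) p k @^-1` B k
      `&` p i @^-1` C) =
  (mu (\bigcap_(k in [set k | (k < n)%N /\ k <> i]) p k @^-1` B k) *
   mu (p i @^-1` C))%E.
Proof.
move=> i0 mB mC.
pose E D := \bigcap_(k in In0 H n th) p k @^-1` (if k == i then D else B k).
pose E1 := \bigcap_(k in In1 H n th) p k @^-1` B k.
have split D : \bigcap_(k in [set k | (k < n)%N /\ k <> i]) p k @^-1` B k
    `&` p i @^-1` D = E D `&` E1.
  apply/seteqP; split => x.
    move=> [h Dx]; split => k /= [kn Hk].
      by case: eqP => [->|ki] //; apply: h.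
    by apply: h; split => // ki; apply: Hk; rewrite ki; case: i0.
  move=> [h0 h1]; split => [k /= [kn ki]|].
    have [Hk|Hk] := pselect (H k th); last exact: h1.
    by have := h0 k (conj kn Hk); rewrite /= (introF eqP ki).
  by have := h0 i i0; rewrite /= eqxx.
have mE D : measurable D -> gen_sigma p (In0 H n th) (E D).
  by move=> mD; apply: gen_sigma_bigcap => k; case: ifP.
have mE1 : gen_sigma p (In1 H n th) E1 by exact: gen_sigma_bigcap.
have finI : finite_set (In0 H n th).
  by apply: sub_finite_set (finite_II n) => k [].
rewrite -[in RHS](setIT (\bigcap_(k in _) _)) -(preimage_setT (p i)) !split.
rewrite (indep_null_alt (mE _ mC) mE1) (indep_null_alt (mE _ measurableT) mE1).
by rewrite /E indep_family_remove// -muleA muleC.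
Qed.

End Independence.

(** The finitely many comparisons through which the tests look at the data. *)
Definition profile (R : realType) n (a : nat -> R) (u : n.-tuple R) :
    {ffun 'I_n -> {ffun 'I_n.+1 -> bool}} :=
  [ffun k => [ffun j : 'I_n.+1 => tnth u k <= a j]].

Section Profile.
Context (R : realType) (n : nat) (a : nat -> R).
Implicit Types u v : n.-tuple R.

Lemma profile_tnth u v (k : 'I_n) j : profile a u = profile a v -> (j <= n)%N ->
  (tnth u k <= a j) = (tnth v k <= a j).
Proof.
move=> /ffunP/(_ k); rewrite !ffunE => /ffunP e; rewrite -ltnS => jn.
by have := e (Ordinal jn); rewrite !ffunE.
Qed.

Lemma profile_below u v j : profile a u = profile a v -> (j <= n)%N ->
  below u (a j) = below v (a j).
Proof.
by move=> e jn; apply: eq_card => k; rewrite !inE (profile_tnth _ e).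
Qed.

Lemma profile_su_index lam u v : profile a u = profile a v ->
  su_index lam a u = su_index lam a v.
Proof.
by move=> e; apply: eq_bigl => j; rewrite (profile_below e)// -ltnS.
Qed.

Lemma profile_no_crossing lam C u v : profile a u = profile a v ->
  no_crossing lam a C u = no_crossing lam a C v.
Proof.
by move=> e; apply: eq_forallb => j; rewrite (profile_below e)// -ltnS.
Qed.

Lemma profile_sud_test lam u v : (1 <= lam <= n)%N ->
  profile a u = profile a v -> sud_test lam a u = sud_test lam a v.
Proof.
move=> ln e.
have ord j : (1 <= j <= n)%N -> (ordstat u j <= a j) = (ordstat v j <= a j).
  move=> jn; rewrite !ordstat_leE// (profile_below e)//; by case/andP: jn.
have ie : sud_index lam a u = sud_index lam a v.
  rewrite /sud_index ord//; case: ifP => _; apply: eq_bigl => j.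
    congr (_ && _); apply: eq_forallb => i.
    case li: (lam <= i <= j)%N => //=; rewrite ord// -(ltnS _ n) ltn_ord andbT.
    by case/andP: li => /(leq_trans _) -> //; case/andP: ln.
  case jl: (1 <= j <= lam)%N => //=; rewrite ord//.
  by case/andP: jl => -> /leq_trans; apply; case/andP: ln.
apply/funext => k; rewrite /sud_test ie; congr (_ && _).
apply: profile_tnth => //; rewrite /sud_index.
by case: ifP => _; apply/bigmax_leqP => j _; rewrite -ltnS.
Qed.

End Profile.

Section ProfileLaw.
Context (R : realType) (d : measure_display) (X : measurableType d).
Context (mu : probability X R) (p : nat -> {mfun X >-> R}).
Context (n : nat) (a : nat -> R).

(** The values of coordinate [k] that are compatible with profile [g].  The index
[k] is a natural number, as in the rectangles of [rectangle_indep]; for [k] not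
less than [n] the outer intersection is empty and there is no constraint. *)
Let cell (g : {ffun 'I_n -> {ffun 'I_n.+1 -> bool}}) (k : nat) : set R :=
  \bigcap_(i in [set i : 'I_n | i = k :> nat])
    \bigcap_(j in [set: 'I_n.+1]) [set r | (r <= a j) = g i j].

Let cell_measurable g k : measurable (cell g k).
Proof.
apply: fin_bigcap_measurable => [|i _]; first exact: finite_finset.
apply: fin_bigcap_measurable => [|j _]; first exact: finite_finset.
case: (g i j).
  exact: measurable_le_threshold.
rewrite (_ : [set _ | _] = [set` `](a j), +oo[]).
  exact: measurable_itv.
apply/seteqP; split => r; rewrite /= in_itv/= andbT ltNge.
  by move=> ->.
by move/negbTE.
Qed.

Let profileE u g : (profile a u = g) <-> forall k : 'I_n, cell g k (tnth u k).
Proof.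
split => [<- k i /= ik j _ /=|h].
  by rewrite /profile !ffunE; congr (tnth _ _ <= _); apply: val_inj.
by apply/ffunP => k; apply/ffunP => j; rewrite !ffunE; apply: h.
Qed.

Lemma profile_fiber_measurable g :
  measurable ((fun x => profile a (pvec p n x)) @^-1` [set g]).
Proof.
rewrite (_ : _ @^-1` _ = \bigcap_(k in `I_n) p k @^-1` cell g k); last first.
  apply/seteqP; split => [x /profileE h k /= kn|x h].
    by have := h (Ordinal kn); rewrite tnth_mktuple.
  by apply/profileE => k; rewrite tnth_mktuple; apply: h => /=.
apply: fin_bigcap_measurable => [|k _]; first exact: finite_II.
by rewrite -[_ @^-1` _]setTI; apply: measurable_funP.
Qed.

(** With coordinate [i] set to 0, the profile constrains the other coordinates only,
or is impossible if it disagrees with the value 0 in coordinate [i]. *)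
Let zero_fiberE (i : 'I_n) g :
  (fun x => profile a (zero_coord i (pvec p n x))) @^-1` [set g] =
  if pselect (cell g i 0) then
    \bigcap_(k in [set k | (k < n)%N /\ k <> i]) p k @^-1` cell g k
  else set0.
Proof.
case: pselect => [c0|c0]; apply/seteqP; split => [x /profileE h|x h] //.
- move=> k /= [kn ki]; have := h (Ordinal kn).
  rewrite tnth_zero_coord tnth_mktuple; case: eqP => // e.
  by case: ki; rewrite -e.
- apply/profileE => k; rewrite tnth_zero_coord tnth_mktuple.
  case: eqP => [->//|ki]; apply: h; split => //= e.
  by apply: ki; apply: val_inj.
- by apply: c0; have := h i; rewrite tnth_zero_coord eqxx.
Qed.

Lemma zero_profile_fiber_measurable (i : 'I_n) g :
  measurable ((fun x => profile a (zero_coord i (pvec p n x))) @^-1` [set g]).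
Proof.
rewrite zero_fiberE; case: pselect => /= [c0|_ //].
apply: fin_bigcap_measurable => [|k _].
  by apply: sub_finite_set (finite_II n) => k [].
by rewrite -[_ @^-1` _]setTI; apply: measurable_funP.
Qed.

Context (Theta : Type) (H : nat -> set Theta) (th : Theta).
Hypothesis indep_null : indep_family mu p (In0 H n th).
Hypothesis indep_null_alt : indep_vectors mu p (In0 H n th) (In1 H n th).

(** Each fiber of the profile of the zeroed vector is a rectangle in the other
coordinates, to which [rectangle_indep] applies. *)
Lemma zero_coord_indep (i : 'I_n) (A : set (n.-tuple R)) (C : set R) :
  H i th -> measurable C ->
  (forall u v, profile a u = profile a v -> A u -> A v) ->
  mu ([set x | A (zero_coord i (pvec p n x))] `&` p i @^-1` C) =
  (mu [set x | A (zero_coord i (pvec p n x))] * mu (p i @^-1` C))%E.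
Proof.
move=> Hi mC sat.
apply: (saturated_independent (zero_profile_fiber_measurable i)).
- by rewrite -[_ @^-1` _]setTI; apply: measurable_funP.
- move=> g; rewrite zero_fiberE; case: pselect => c0.
    by apply: (rectangle_indep indep_null indep_null_alt).
  by rewrite set0I measure0 mul0e.
- by move=> x y; apply: sat.
Qed.

End ProfileLaw.

Lemma uniform_prob_le (R : realType) (t : R) : 0 <= t <= 1 ->
  uniform_prob (@ltr01 R) [set r | r <= t] = t%:E.
Proof.
move=> /andP[t0 t1].
rewrite /uniform_prob integral_uniform_pdf.
have -> : [set r : R | r <= t] `&` `[0, 1]%classic = [set` `[0, t]].
  apply/seteqP; split => r; rewrite /= !in_itv/=.
    by move=> [-> /andP[->]].
  by move=> /andP[-> rt]; rewrite rt (le_trans rt).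
rewrite (eq_integral (cst 1%E)); last first.
  move=> r; rewrite inE /= in_itv/= => /andP[r0 rt].
  by rewrite /uniform_pdf r0 (le_trans rt)// subr0 invr1.
rewrite integral_cst// mul1e/= lebesgue_measure_itv/= lte_fin.
case: ltgtP t0 => // [_|<-] _; by rewrite ?sube0.
Qed.

(** * Bounds on the false discovery rate for a fixed number of hypotheses *)

Section FDRBounds.
Context (R : realType) (d : measure_display) (X : measurableType d).
Context (mu : probability X R) (p : nat -> {mfun X >-> R}).
Context (Theta : Type) (H : nat -> set Theta) (th : Theta).
Context (n lam : nat) (a : nat -> R) (C : pred nat).
Hypotheses (lam_range : (1 <= lam <= n)%N) (C_lam : C lam).
Hypothesis a01 : forall j, (j <= n)%N -> 0 <= a j <= 1.
Hypothesis a_le : forall j k, (j <= k <= n)%N -> a j <= a k.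
Hypothesis indep_null : indep_family mu p (In0 H n th).
Hypothesis indep_null_alt : indep_vectors mu p (In0 H n th) (In1 H n th).
Hypothesis unif : forall i, In0 H n th i -> uniform01 mu (p i).

Let u x : n.-tuple R := pvec p n x.
Let v i x := zero_coord i (u x).
Let phi : mtest R n := sud_test lam a.
Let good i x := no_crossing lam a C (v i x).
Let term i x : R := (phi (u x) i)%:R / (maxn (Rnum phi (u x)) 1)%:R.
Let event i j : set X := [set x | good i x /\ su_index lam a (v i x) = j].
Let hit i (j : nat) : set X := p i @^-1` [set r | r <= a j].

(** The added 1 is the most by which zeroing a coordinate can raise a count.  Off
this event, [no_crossing] therefore holds for the vectors with any one
coordinate zeroed. *)
Definition near_crossing : set X :=
  [set x | exists j, [/\ (1 <= j <= lam)%N, C j &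
                         (j <= (below (pvec p n x) (a j)).+1)%N]].

Let a_ge0 j : (j <= n)%N -> 0 <= a j. Proof. by move=> /a01/andP[]. Qed.
Let lamn : (lam <= n)%N. Proof. by case/andP: lam_range. Qed.

Let event_measurable i j : measurable (event i j).
Proof.
apply: (saturated_measurable (@zero_profile_fiber_measurable _ _ _ p n a i)).
move=> x y e [gx sx]; split.
  by rewrite /good -(profile_no_crossing lam C e).
by rewrite -sx; apply/esym/profile_su_index.
Qed.

Let good_measurable i : measurable [set x | good i x].
Proof.
apply: (saturated_measurable (@zero_profile_fiber_measurable _ _ _ p n a i)).
by move=> x y e /=; rewrite /good -(profile_no_crossing lam C e).
Qed.

Let hit_measurable i j : measurable (hit i j).
Proof.
rewrite /hit -[_ @^-1` _]setTI; apply: measurable_funP => //.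
exact: measurable_le_threshold.
Qed.

Lemma near_crossing_measurable : measurable near_crossing.
Proof.
apply: (saturated_measurable (@profile_fiber_measurable _ _ _ p n a)).
move=> x y e [j [jl Cj h]]; exists j; split=> //.
by rewrite -(profile_below e)//; case/andP: jl => _ /leq_trans; apply.
Qed.

Let not_near_crossing_good i x : ~ near_crossing x -> good i x.
Proof.
move=> h; apply/no_crossingP => // j jl Cj; rewrite ltnNge; apply/negP => jb.
by apply: h; exists j; split => //; apply: leq_trans jb (below_zero_coordS _ _ _).
Qed.

Let term_ge0 i x : 0 <= term i x.
Proof. by rewrite divr_ge0. Qed.

Let FDPE x : (Vnum H th phi (u x))%:R / (maxn (Rnum phi (u x)) 1)%:R =
  \sum_(i < n | th \in H i) term i x.
Proof.
rewrite -mulr_suml -natr_sum; congr (_%:R / _).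
rewrite /Vnum -sum1_card big_mkcond [RHS]big_mkcond; apply: eq_bigr => i _.
by rewrite inE; case: (phi _ _); case: (th \in _).
Qed.

Let FDP_le1 x : (Vnum H th phi (u x))%:R / (maxn (Rnum phi (u x)) 1)%:R <= 1 :> R.
Proof.
have m0 : 0 < (maxn (Rnum phi (u x)) 1)%:R :> R by rewrite ltr0n leq_max orbT.
rewrite ler_pdivrMr// mul1r ler_nat leq_max; apply/orP; left.
by apply: subset_leq_card; apply/fintype.subsetP => i; rewrite !inE => /andP[].
Qed.

Let good_termE i x : (good i x)%:R * term i x =
  \sum_(j < n.+1) (j%:R^-1 * \1_(event i j `&` hit i j) x).
Proof.
have [gx|/negbTE gx] := boolP (good i x); last first.
  rewrite mul0r big1// => j _; rewrite indicE.
  by case: (boolP (x \in _)); rewrite ?mulr0// inE => -[[]]; rewrite gx.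
rewrite mul1r /term (rejection_zero_coord lam_range C_lam a_ge0 a_le gx).
have rn : (su_index lam a (v i x) < n.+1)%N.
  by rewrite ltnS (leq_trans (su_index_le _ _ _)).
rewrite (bigD1 (Ordinal rn))//= [X in _ + X]big1 ?addr0 => [|j jr]; last first.
  rewrite indicE; case: (boolP (x \in _)); rewrite ?mulr0// inE => -[[_ e] _].
  by move: jr; rewrite -val_eqE /= e eqxx.
rewrite mulrC indicE; congr (_ * _%:R); congr nat_of_bool.
rewrite {1}/u tnth_mktuple; apply/idP/idP => [h|]; last by rewrite inE => -[].
by rewrite inE.
Qed.

(** The selected index is positive, since the zeroed coordinate lies below every
threshold, and the count attains it, which [no_crossing] excludes on [C]. *)
Let event_empty i (j : nat) : (j == 0%N) || C j -> event i j = set0.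
Proof.
move=> h; rewrite -subset0 => x [gx e].
have j0 : (0 < j)%N by rewrite -e su_index_zero_coord_gt0.
have jl : (j <= lam)%N by rewrite -e su_index_le.
move: h; rewrite gtn_eqF//= => Cj.
have := no_crossingP _ _ _ lamn gx j; rewrite j0 jl => /(_ isT Cj).
have := @su_index_below _ _ lam a (v i x); rewrite e => /(_ j0).
by rewrite ltnNge => ->.
Qed.

Let event_hit (i : 'I_n) (j : 'I_n.+1) : H i th ->
  mu (event i j `&` hit i j) = (mu (event i j) * (a j)%:E)%E.
Proof.
move=> Hi; have mle : measurable [set r : R | r <= a j].
  exact: measurable_le_threshold.
pose A (w : n.-tuple R) : Prop := no_crossing lam a C w /\ su_index lam a w = j.
rewrite (zero_coord_indep (a := a) indep_null indep_null_alt (A := A) Hi mle).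
  by rewrite unif// uniform_prob_le// a01// -ltnS.
move=> w w' e [gw sw]; split; first by rewrite -(profile_no_crossing lam C e).
by rewrite -sw; apply/esym/profile_su_index.
Qed.

Let good_sum i : mu [set x | good i x] = (\sum_(j < n.+1) mu (event i j))%E.
Proof.
rewrite -(@measure_bigsetU_ord _ _ _ mu n.+1 xpredT (event i))//; last first.
  by move=> j k _ _ [x [[_ e] [_ e']]]; apply: val_inj; rewrite /= -e -e'.
congr (mu _); apply/seteqP; split => x.
  move=> gx; rewrite -bigcup_mkord; exists (su_index lam a (v i x)) => //=.
  by rewrite ltnS (leq_trans (su_index_le _ _ _)).
by rewrite -bigcup_mkord => -[j _ []].
Qed.

(** The false discovery proportion restricted, null by null, to the event on which
[rejection_zero_coord] describes the contribution of that null.  It differs from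
the full proportion only on [near_crossing]. *)
Let good_FDP x : R := \sum_(i < n | th \in H i) (good i x)%:R * term i x.

Let pr A := fine (mu A).

Let prE A : measurable A -> mu A = (pr A)%:E.
Proof. by move=> mA; rewrite fineK// fin_num_measure. Qed.

Let pr_ge0 A : 0 <= pr A.
Proof. by rewrite fine_ge0. Qed.

Let good_FDP_measurable : measurable_fun setT good_FDP.
Proof.
rewrite (_ : good_FDP = fun x =>
   \sum_(i <- [seq i : 'I_n <- index_enum 'I_n | th \in H i])
   \sum_(j < n.+1) (j%:R^-1 * \1_(event i j `&` hit i j) x)); last first.
  apply/funext => x; rewrite big_filter; apply: eq_bigr => i _.
  exact: good_termE.
apply: measurable_sum => i; apply: measurable_sum => j.
apply: measurable_funM => //; apply: measurable_indic; exact: measurableI.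
Qed.

Let good_FDP_expectation : ('E_mu[good_FDP] = (\sum_(i < n | th \in H i)
  \sum_(j < n.+1) (j%:R^-1 * (pr (event i j) * a j)))%:E)%E.
Proof.
have mI i j : measurable (event i j `&` hit i j) by exact: measurableI.
pose F i (j : 'I_n.+1) x : \bar R := (j%:R^-1 * \1_(event i j `&` hit i j) x)%:E.
have F0 i j x : (0 <= F i j x)%E by rewrite lee_fin mulr_ge0// invr_ge0.
have mF i j : measurable_fun setT (F i j).
  apply/measurable_EFinP; apply: measurable_funM => //; exact: measurable_indic.
rewrite unlock.
rewrite (eq_integral (fun x =>
    \sum_(i <- [seq i : 'I_n <- index_enum 'I_n | th \in H i])
    \sum_(j < n.+1) F i j x)%E); last first.
  move=> x _; rewrite /good_FDP big_filter -sumEFin; apply: eq_bigr => i _.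
  by rewrite good_termE sumEFin.
rewrite ge0_integral_sum//; last 2 first.
  by move=> i; apply: emeasurable_sum.
  by move=> i x _; apply: sume_ge0 => j _.
rewrite big_filter -sumEFin; apply: eq_bigr => i; rewrite inE => Hi.
rewrite ge0_integral_sum// -sumEFin; apply: eq_bigr => j _.
rewrite /F; under eq_integral do rewrite EFinM.
rewrite ge0_integralZl_EFin//; last first.
  by apply/measurable_EFinP; exact: measurable_indic.
rewrite integral_indic// setIT [X in (_ * X)%E](event_hit j Hi).
by rewrite (prE (event_measurable i j)).
Qed.

(** The numbers [lo] and [hi] bound a j / j, which is q(j/n) / n for the critical
values of interest, over the indices that can be selected. *)
Lemma FDR_bounds (lo hi : R) : 0 <= lo -> 0 <= hi ->
  (forall j, (1 <= j <= n)%N -> ~~ C j -> lo * j%:R <= a j <= hi * j%:R) ->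
  exists2 r : R,
    ('E_mu[fun x => ((Vnum H th phi (pvec p n x))%:R /
                     (maxn (Rnum phi (pvec p n x)) 1)%:R)%R] = r%:E)%E &
    (n0 H th n)%:R * lo * (1 - fine (mu near_crossing)) <= r
      <= (n0 H th n)%:R * hi + fine (mu near_crossing).
Proof.
move=> lo0 hi0 lohi.
pose f x : R := (Vnum H th phi (pvec p n x))%:R /
  (maxn (Rnum phi (pvec p n x)) 1)%:R.
have good_FDPE := good_FDP_expectation; set s := \sum_(i < n | th \in H i)
  \sum_(j < n.+1) (j%:R^-1 * (pr (event i j) * a j)) in good_FDPE.
have mE : measurable near_crossing := near_crossing_measurable.
have good_FDP_ge0 x : 0 <= good_FDP x.
  by apply: sumr_ge0 => i _; rewrite mulr_ge0.
have good_FDP_le x : good_FDP x <= f x.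
  rewrite /f [leRHS]FDPE; apply: ler_sum => i _.
  by rewrite ler_piMl//; case: (good i x); rewrite ?ler01.
have le_good_FDP x : f x <= good_FDP x + \1_near_crossing x.
  rewrite indicE; have [nx|nx] := pselect (near_crossing x).
    by rewrite mem_set//; apply: le_trans (FDP_le1 x) _; rewrite lerDr.
  rewrite memNset// addr0 /f FDPE; apply: ler_sum => i _.
  by rewrite not_near_crossing_good// mul1r.
have mf : measurable_fun setT f.
  apply: (saturated_measurable_fun (@profile_fiber_measurable _ _ _ p n a)).
  by move=> x y e; rewrite /f /Vnum /Rnum /phi (profile_sud_test lam_range e).
have f0 x : 0 <= f x by apply: le_trans (good_FDP_ge0 x) (good_FDP_le x).
have Ele : ('E_mu[f] <= s%:E + mu near_crossing)%E.
  rewrite -good_FDPE unlock.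
  have -> : mu near_crossing = (\int[mu]_x (\1_near_crossing x)%:E)%E.
    by rewrite integral_indic// setIT.
  have -> : (\int[mu]_x (good_FDP x)%:E + \int[mu]_x (\1_near_crossing x)%:E =
      \int[mu]_x ((good_FDP x)%:E + (\1_near_crossing x)%:E))%E.
    rewrite ge0_integralD//; first by move=> x _; rewrite lee_fin.
      exact/measurable_EFinP.
    by apply/measurable_EFinP; exact: measurable_indic.
  apply: ge0_le_integral => //.
  - by move=> x _; rewrite lee_fin.
  - exact/measurable_EFinP.
  - by apply/measurable_EFinP; apply: measurable_funD.
  - by move=> x _; rewrite lee_fin.
have Ege : (s%:E <= 'E_mu[f])%E.
  rewrite -good_FDPE; apply: expectation_le => //; exact: aeW.
rewrite (prE mE) -EFinD in Ele.
have Efin : ('E_mu[f])%E \is a fin_num.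
  rewrite fin_numE -ltNye -ltey (lt_le_trans _ Ege) ?ltNyr//=.
  by rewrite (le_lt_trans Ele) ?ltry.
exists (fine ('E_mu[f])%E); first by rewrite fineK.
rewrite -(fineK Efin) !lee_fin in Ege Ele.
have n0E (c : R) : \sum_(i < n | th \in H i) c = (n0 H th n)%:R * c.
  by rewrite sumr_const mulr_natl.
have good_pr i : pr [set x | good i x] = \sum_(j < n.+1) pr (event i j).
  apply: EFin_inj; rewrite -prE// good_sum -sumEFin.
  by apply: eq_bigr => j _; rewrite -prE.
have jbound i (j : 'I_n.+1) : lo * pr (event i j) <=
    j%:R^-1 * (pr (event i j) * a j) <= hi * pr (event i j).
  have [/event_empty ->|] := boolP ((j == 0%N :> nat) || C j).
    by rewrite /pr measure0 !(mul0r, mulr0) lexx.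
  rewrite negb_or -lt0n => /andP[j0 Cj].
  have /andP[h1 h2] := lohi j (introT andP (conj j0 (ltn_ord j))) Cj.
  have j0' : 0 < j%:R :> R by rewrite ltr0n.
  rewrite mulrCA !(mulrC _ (pr _)) !ler_wpM2l// mulrC.
    by rewrite ler_pdivrMr.
  by rewrite ler_pdivlMr.
apply/andP; split.
  apply: le_trans Ege; rewrite -mulrA -n0E; apply: ler_sum => i Hi.
  apply: (@le_trans _ _ (\sum_(j < n.+1) lo * pr (event i j))); last first.
    by apply: ler_sum => j _; case/andP: (jbound i j).
  rewrite -mulr_sumr ler_wpM2l// -good_pr lerBlDr.
  rewrite -lee_fin EFinD -!prE// -(probability_setT mu).
  apply: le_trans (measureU2 _ _ _) => //; apply: le_measure; rewrite ?inE//.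
    exact: measurableU.
  move=> x _; have [|nx] := pselect (near_crossing x); first by right.
  by left; exact: not_near_crossing_good.
apply: (le_trans Ele); rewrite lerD2r -n0E; apply: ler_sum => i Hi.
apply: (@le_trans _ _ (\sum_(j < n.+1) hi * pr (event i j))).
  by apply: ler_sum => j _; case/andP: (jbound i j).
rewrite -mulr_sumr -good_pr ler_piMr// -lee_fin -prE//.
exact: probability_le1.
Qed.

End FDRBounds.

(** * Limits along sequences and filters *)

Lemma limf_esup_cvg (R : realType) (T : topologicalType) (F : set_system T)
    {FF : ProperFilter F} (g : T -> R) (l : R) :
  g @ F --> l -> limf_esup (fun x => (g x)%:E) F = l%:E.
Proof.
move=> /cvgrPdist_le gl; rewrite limf_esupE; apply/eqP; rewrite eq_le.
apply/andP; split; apply/lee_addgt0Pr => e e0.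
  apply: (@le_trans _ _ (ereal_sup ((fun x => (g x)%:E) @`
      [set x | `|l - g x| <= e]))).
    by apply: ereal_inf_lbound; exists [set x | `|l - g x| <= e] => //; exact: gl.
  apply: ge_ereal_sup => _ [x /= xe <-].
  by rewrite -EFinD lee_fin; move: xe; rewrite ler_distlC => /andP[].
rewrite -leeBlDr//; apply: le_ereal_inf_tmp => _ [V FV <-].
have [x [xe Vx]] := filter_ex (filterI (gl e e0) FV).
apply: (@le_trans _ _ (g x)%:E); last by apply: ereal_sup_ubound; exists x.
by rewrite -EFinB lee_fin; move: xe; rewrite ler_distlC => /andP[].
Qed.

Lemma limn_einf_gt (R : realType) (u : nat -> \bar R) (c : R) :
  (c%:E < limn_einf u)%E ->
  exists2 e : R, c < e & \forall n \near \oo, (e%:E < u n)%E.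
Proof.
rewrite (_ : limn_einf u = limf_einf u \oo)// limf_einfE.
move=> /ereal_sup_gt[_ [V FV <-]] cV.
have [e ce eV] : exists2 e : R, c < e & (e%:E < ereal_inf (u @` V))%E.
  case: (ereal_inf _) cV => [r| |//]; rewrite ?lte_fin => cr.
    by exists ((c + r) / 2); rewrite ?lte_fin; have [] := midf_lt cr.
  by exists (c + 1); rewrite ?ltrDl ?ltry.
exists e => //; apply: filterS FV => n Vn; apply: (lt_le_trans eV).
by apply: ereal_inf_lbound; exists n.
Qed.

Lemma limn_esup_lt (R : realType) (u : nat -> \bar R) (c : \bar R) :
  (limn_esup u < c)%E -> \forall n \near \oo, (u n < c)%E.
Proof.
rewrite /limn_esup limf_esupE => /ereal_inf_lt[_ [V FV <-]] Vc.
apply: filterS FV => n Vn; apply: le_lt_trans Vc.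
by apply: ereal_sup_ubound; exists n.
Qed.

(** Almost surely only finitely many of the events occur, so that the upper limit
of the events is negligible, and continuity from above applies to the tails. *)
Lemma ae_eventually_notin (R : realType) (d : measure_display)
    (X : measurableType d) (mu : probability X R) (E : nat -> set X) :
  (forall n, measurable (E n)) ->
  {ae mu, forall x, \forall n \near \oo, ~ E n x} ->
  fine (mu (E n)) @[n --> \oo] --> 0.
Proof.
move=> mE aeE.
have mU n : measurable (\bigcup_(k >= n) E k) by exact: bigcup_measurable.
have E0 : mu (lim_sup_set E) = 0%E.
  apply/negligibleP; first exact: bigcap_measurableType.
  apply: negligibleS aeE => x limx [N _ h].
  by have [n Nn En] := limx N I; exact: h Nn En.
have cvgE : mu (\bigcup_(k >= n) E k) @[n --> \oo] --> mu (lim_sup_set E).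
  apply: lim_sup_set_cvg => //.
  by rewrite (le_lt_trans (probability_le1 _ _)) ?ltry.
rewrite E0 in cvgE; have /fine_cvgP[_ cvgU] := cvgE.
apply: (@squeeze_cvgr _ _ _ _ (fun=> 0)
  (fun n => fine (mu (\bigcup_(k >= n) E k)))) => //.
  apply: nearW => n; rewrite fine_ge0//= fine_le ?fin_num_measure//.
  by apply: le_measure; rewrite ?inE// => x Ex; exists n => /=.
exact: cvg_cst.
Qed.

(** * The limit of the false discovery rate *)

(** At t = j/n, the event [near_crossing] bounds the gap by 1/n. *)
Lemma gap_not_near_crossing (R : realType) (d : measure_display)
    (X : measurableType d) (p : nat -> {mfun X >-> R}) (n lam : nat)
    (rho : R -> R) (eps K delta : R) (x : X) :
  (0 < n)%N -> lam%:R / n%:R <= K -> n%:R^-1 <= delta ->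
  (delta%:E < ereal_inf [set (t - Fhat (pvec p n x) (rho t))%R%:E |
                  t in [set t : R | (eps <= t <= K)%R]])%E ->
  ~ near_crossing p n lam (crit rho n) (fun j => eps <= j%:R / n%:R) x.
Proof.
move=> n0 lamK nd gap [j [/andP[j1 jl] epsj jb]].
have n0' : 0 < n%:R :> R by rewrite ltr0n.
have jK : j%:R / n%:R <= K.
  by apply: le_trans lamK; rewrite ler_pM2r ?invr_gt0// ler_nat.
have : (delta%:E < (j%:R / n%:R - Fhat (pvec p n x) (rho (j%:R / n%:R)))%:E)%E.
  apply: (lt_le_trans gap); apply: ereal_inf_lbound.
  by exists (j%:R / n%:R) => //=; rewrite epsj jK.
rewrite lte_fin => /(le_lt_trans nd); apply/negP; rewrite -leNgt.
rewrite /Fhat -mulrBl ler_pdivrMr// mulVf ?gt_eqF// lerBlDr.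
by rewrite -[1]/(1%:R) -natrD ler_nat add1n.
Qed.

(** The bounds of [FDR_bounds] are applied with lo and hi equal to l - eta and
l + eta over n, valid for the ranks j < eps * n; lo is cut off at 0 to stay
nonnegative.  The remaining error is the probability of [near_crossing], which
vanishes because of the gap. *)
Lemma FDR_limit (R : realType) (d : measure_display) (X : measurableType d)
  (Theta : Type) (P : Theta -> probability X R)
  (H : nat -> set Theta) (p : nat -> {mfun X >-> R}) (th : Theta)
  (rho : R -> R) (rho_cvf : critical_value_function rho)
  (lam : nat -> nat) (lam_range : forall n, (0 < n)%N -> (1 <= lam n <= n)%N)
  (phi : forall n, mtest R n)
  (phi_sud : forall n, (0 < n)%N -> phi n = sud_test (lam n) (crit rho n))
  (eps0 : R) (eps0_gt0 : 0 < eps0)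
  (lam_ge : \forall n \near \oo, eps0 <= (lam n)%:R / n%:R)
  (hD3 : forall n, (0 < n)%N -> condD3 P H p n)
  (hI1 : forall n, (0 < n)%N -> condI1 P H p n)
  (hI2 : forall n, (0 < n)%N -> condI2 P H p n)
  (zeta : R) (zeta_lim : ((n0 H th n)%:R / n%:R : R) @[n --> \oo] --> zeta)
  (K : R) (lam_K : \forall n \near \oo, (lam n)%:R / n%:R <= K)
  (gap : forall eps : R, 0 < eps ->
     {ae P th, forall x,
        (0 < limn_einf (fun n => ereal_inf
               [set (t - Fhat (pvec p n x) (rho t))%R%:E |
                  t in [set t : R | (eps <= t <= K)%R]]))%E})
  (l : R) (q_lim : rho x / x @[x --> (0 : R)^'+] --> l) (l01 : 0 <= l <= 1) :
  FDR P H p th (phi n) @[n --> \oo] --> (zeta * l)%:E.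
Proof.
have [rho01 rho_le rho_cont rho0 rho_gt0] := rho_cvf.
pose C eps n j := (eps <= j%:R / n%:R :> R).
pose e eps n := fine (P th (near_crossing p n (lam n) (crit rho n) (C eps n))).
have in01 n j : (0 < n)%N -> (j <= n)%N -> (j%:R / n%:R : R) \in `[0, 1].
  move=> n0 jn; rewrite in_itv/= divr_ge0//=.
  by rewrite ler_pdivrMr ?ltr0n// mul1r ler_nat.
have a01 n j : (0 < n)%N -> (j <= n)%N -> 0 <= crit rho n j <= 1.
  by move=> n0 jn; have := rho01 _ (in01 _ _ n0 jn); rewrite in_itv.
have a_le n j k : (0 < n)%N -> (j <= k <= n)%N -> crit rho n j <= crit rho n k.
  move=> n0 /andP[jk kn]; apply: rho_le; rewrite ?in01 ?(leq_trans jk)//.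
  by rewrite ler_pM2r ?invr_gt0 ?ltr0n// ler_nat.
have e_cvg (eps : R) : 0 < eps -> e eps n @[n --> \oo] --> 0.
  (* The shift discards n = 0, for which the order of the test is arbitrary. *)
  move=> eps_gt0; rewrite -(cvg_shiftS (e eps)).
  apply: (@ae_eventually_notin _ _ _ (P th)
    (fun n => near_crossing p n.+1 (lam n.+1) (crit rho n.+1) (C eps n.+1))).
    by move=> n; apply: near_crossing_measurable; exact: lam_range.
  have := gap _ eps_gt0; apply: filterS => x /limn_einf_gt[delta delta0 dgap].
  have [N _ h] : \forall n \near \oo,
      ~ near_crossing p n (lam n) (crit rho n) (C eps n) x.
    near=> n; apply: (@gap_not_near_crossing _ _ _ _ _ _ _ _ K delta).
    - by near: n; exact: nbhs_infty_gt.
    - by near: n.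
    - rewrite invf_ple ?posrE//; first by near: n; exact: nbhs_infty_ger.
      by rewrite ltr0n; near: n; exact: nbhs_infty_gt.
    - by near: n.
  by exists N => // n Nn; apply: h; exact: leqW.
have q_near (eta : R) : 0 < eta -> exists2 eps, 0 < eps <= eps0 &
    forall t, 0 < t < eps -> l - eta <= rho t / t <= l + eta.
  move=> eta_gt0; have /cvgrPdist_le/(_ _ eta_gt0) [r /= r0 hr] := q_lim.
  exists (Num.min r eps0); first by rewrite lt_min r0 eps0_gt0 ge_min lexx orbT.
  move=> t /andP[t0]; rewrite lt_min => /andP[tr _].
  rewrite -ler_distlC; apply: hr => //=.
  by rewrite sub0r normrN gtr0_norm.
have bounds (eta : R) : 0 < eta -> exists2 eps, 0 < eps &
    \forall n \near \oo, exists2 r : R, FDR P H p th (phi n) = r%:E &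
      (n0 H th n)%:R / n%:R * Num.max (l - eta) 0 * (1 - e eps n) <= r
      <= (n0 H th n)%:R / n%:R * (l + eta) + e eps n.
  move=> eta_gt0; have [eps /andP[eps_gt0 eps_le] q_eps] := q_near _ eta_gt0.
  exists eps => //; near=> n.
  have n_gt0 : (0 < n)%N by near: n; exact: nbhs_infty_gt.
  have n_gt0' : 0 < n%:R :> R by rewrite ltr0n.
  have C_lam : C eps n (lam n) by apply: (le_trans eps_le); near: n.
  have [l0 l1] := andP l01.
  have := @FDR_bounds R d X (P th) p Theta H th n (lam n) (crit rho n) (C eps n)
    (lam_range _ n_gt0) C_lam (fun j => a01 n j n_gt0) (fun j k => a_le n j k n_gt0)
    (proj1 (hI1 _ n_gt0 th)) (hI2 _ n_gt0 th) (hD3 _ n_gt0 th)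
    (Num.max (l - eta) 0 / n%:R) ((l + eta) / n%:R).
  case.
  - by rewrite divr_ge0// le_max lexx orbT.
  - by rewrite divr_ge0// addr_ge0// ltW.
  - move=> j /andP[j1 jn]; rewrite /C -ltNge => j_eps.
    have jn0 : 0 < j%:R / n%:R :> R by rewrite divr_gt0 ?ltr0n.
    have /andP[lo hi] := q_eps _ (introT andP (conj jn0 j_eps)).
    have cE c : c / n%:R * j%:R = c * (j%:R / n%:R) :> R by rewrite mulrAC mulrA.
    rewrite !cE; apply/andP; split; last by rewrite -ler_pdivrMr.
    rewrite -ler_pdivlMr// ge_max lo /= divr_ge0 ?(ltW jn0)//.
    by have /andP[] := a01 n j n_gt0 jn.
  - move=> r Er; rewrite !mulrA ![_ * _ / n%:R]mulrAC => r_bounds.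
    by exists r => //; rewrite phi_sud.
apply/fine_cvgP; split.
  have [eps _ h] := bounds 1 ltr01.
  by apply: filterS h => n [r -> _].
apply/cvgrPdist_lt => eta eta0.
(* The ratio n_0/n, the values of q, and the probability of the exceptional event
   contribute at most a quarter of eta each. *)
have eta4 : 0 < eta / 4 by rewrite divr_gt0.
have [eps eps0' h] := bounds _ eta4.
have /cvgrPdist_lt/(_ _ eta4) zeta_near := zeta_lim.
have /cvgrPdist_lt/(_ _ eta4) e_near := e_cvg _ eps0'.
near=> n.
have [r Er /andP[lo hi]] : exists2 r : R, FDR P H p th (phi n) = r%:E &
      (n0 H th n)%:R / n%:R * Num.max (l - eta / 4) 0 * (1 - e eps n) <= r
      <= (n0 H th n)%:R / n%:R * (l + eta / 4) + e eps n by near: n.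
have ze : `|zeta - (n0 H th n)%:R / n%:R| < eta / 4.
  by near: n.
have ee : `|0 - e eps n| < eta / 4 by near: n.
have n_gt0 : (0 < n)%N by near: n; exact: nbhs_infty_gt.
set A := (n0 H th n)%:R / n%:R in lo hi ze.
have A0 : 0 <= A by rewrite divr_ge0.
have A1 : A <= 1.
  rewrite ler_pdivrMr ?ltr0n// mul1r ler_nat /n0.
  by rewrite (leq_trans (max_card _))// card_ord.
have e0 : 0 <= e eps n by rewrite fine_ge0.
rewrite sub0r normrN ger0_norm// in ee.
have [l0 l1] := andP l01.
move: ze; rewrite ltr_distlC => /andP[ze1 ze2].
set m := Num.max _ _ in lo.
have m1 : m <= 1 by rewrite ge_max ler01 andbT lerBlDr (le_trans l1)// lerDl ltW.
have m0 : 0 <= m by rewrite le_max lexx orbT.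
have ml : l - eta / 4 <= m by rewrite le_max lexx.
have Al1 : A * l <= zeta * l + eta / 4.
  have : (A - zeta) * l <= eta / 4 by nra.
  by rewrite mulrBl; lra.
have Al2 : zeta * l - eta / 4 <= A * l.
  have : (zeta - A) * l <= eta / 4 by nra.
  by rewrite mulrBl; lra.
have Ah : A * (eta / 4) <= eta / 4 by rewrite ler_piMl// ltW.
have Am : A * (l - eta / 4) <= A * m by rewrite ler_wpM2l.
have AmE : A * m * e eps n <= e eps n by rewrite ler_piMl// mulr_ile1.
rewrite mulrBr mulr1 in lo; rewrite mulrBr in Am; rewrite mulrDr in hi.
by rewrite /= Er /= ltr_distlC; apply/andP; split; lra.
Unshelve. all: end_near.
Qed.

(** Dividing rho <= f_alpha_inv by x gives a bound that tends to alpha at 0. *)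
Lemma ratio_limit_le (R : realType) (alpha : R) (rho : R -> R) (l : R) :
  0 < alpha < 1 ->
  (forall t, t \in `[0, 1] -> rho t <= f_alpha_inv alpha t) ->
  rho x / x @[x --> (0 : R)^'+] --> l -> l <= alpha.
Proof.
move=> /andP[alpha0 alpha1] rho_le rho_l.
have bound_cvg : alpha / (1 - (1 - alpha) * x) @[x --> (0 : R)^'+] --> alpha.
  have {3}-> : alpha = alpha / (1 - (1 - alpha) * 0).
    by rewrite mulr0 subr0 divr1.
  apply: cvgM; first exact: cvg_cst.
  apply: cvgV; first by rewrite mulr0 subr0 oner_eq0.
  apply: cvgB; first exact: cvg_cst.
  apply: cvgM; first exact: cvg_cst.
  exact: cvg_at_right_filter.
apply: (ler_cvg_to rho_l bound_cvg); near=> x.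
have x0 : 0 < x by [].
have x1 : x < 1 by near: x; exact: nbhs_right_lt.
rewrite ler_pdivrMr// mulrAC; apply: rho_le.
by rewrite in_itv/= !ltW.
Unshelve. all: end_near.
Qed.

Theorem theorem5p4 (R : realType) (d : measure_display) (X : measurableType d)
  (Theta : Type) (P : Theta -> probability X R)
  (H : nat -> set Theta) (H_nonempty : forall i, H i !=set0)
  (p : nat -> {mfun X >-> R}) (p_pvalue : forall i, pvalue P (H i) (p i))
  (PDU : set nat -> probability X R)
  (PDU_dirac_uniform : forall J, dirac_uniform (PDU J) p J)
  (Pz : Theta -> nat -> probability X R)
  (Pz_law : forall th i, I0 H th i ->
     same_law (Pz th i) (P th) (fun k => p k) (zeroed p i))
  (alpha : R) (alpha01 : 0 < alpha < 1) (th : Theta)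
  (rho : R -> R) (rho_cvf : critical_value_function rho)
  (rho_le : forall t, t \in `[0, 1] -> rho t <= f_alpha_inv alpha t)
  (lam : nat -> nat) (lam_range : forall n, (0 < n)%N -> (1 <= lam n <= n)%N)
  (lam_liminf : (0 < limn_einf (fun n => ((lam n)%:R / n%:R : R)%:E))%E)
  (phi : forall n, mtest R n)
  (phi_sud : forall n, (0 < n)%N -> phi n = sud_test (lam n) (crit rho n))
  (hT1 : forall n, (0 < n)%N -> condT1 p (crit rho n) (phi n))
  (hT2 : forall n, (0 < n)%N -> condT2 p (crit rho n) (phi n))
  (hD1 : forall n, (0 < n)%N -> condD1 P H p (crit rho n) (phi n))
  (hD2 : forall n, (0 < n)%N -> condD2 P Pz H p (crit rho n) (phi n))
  (hD3 : forall n, (0 < n)%N -> condD3 P H p n)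
  (hI1 : forall n, (0 < n)%N -> condI1 P H p n)
  (hI2 : forall n, (0 < n)%N -> condI2 P H p n)
  (hA1 : forall n, (0 < n)%N -> condA1 P Pz PDU H p (phi n))
  (zeta : R) (zeta01 : 0 <= zeta <= 1)
  (zeta_lim : ((n0 H th n)%:R / n%:R : R) @[n --> \oo] --> zeta)
  (K : R) (K01 : 0 <= K <= 1)
  (K_gt : (limn_esup (fun n => ((lam n)%:R / n%:R : R)%:E) < 1)%E ->
     (limn_esup (fun n => ((lam n)%:R / n%:R : R)%:E) < K%:E)%E)
  (K_eq1 : ~ (limn_esup (fun n => ((lam n)%:R / n%:R : R)%:E) < 1)%E -> K = 1)
  (* in \bar R, so that the infimum over an empty range of t is +oo *)
  (gap : forall eps : R, 0 < eps ->
     {ae P th, forall x,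
        (0 < limn_einf (fun n => ereal_inf
               [set (t - Fhat (pvec p n x) (rho t))%R%:E |
                  t in [set t : R | (eps <= t <= K)%R]]))%E})
  (q_cvg : cvg (q rho x @[x --> (0 : R)^'+])) :
  [/\ FDR P H p th (phi n) @[n --> \oo] -->
        (zeta * lim (q rho x @[x --> (0 : R)^'+]))%:E,
      zeta * lim (q rho x @[x --> (0 : R)^'+]) = zeta * q rho 0,
      zeta * q rho 0 = zeta * qbar rho 0 &
      zeta * qbar rho 0 <= zeta * alpha].
Proof.
have [alpha0 alpha1] := andP alpha01.
have [rho01 _ _ _ _] := rho_cvf.
set l := lim _.
have q_ratio : \forall x \near (0 : R)^'+, q rho x = rho x / x.
  by near=> x; rewrite /q gt_eqF.
have ratio_l : rho x / x @[x --> (0 : R)^'+] --> l.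
  by apply: cvg_trans q_cvg; exact: near_eq_cvg.
have l_alpha : l <= alpha by exact: ratio_limit_le rho_le ratio_l.
have l0 : 0 <= l.
  apply: limr_ge => //; near=> x; have x0 : 0 < x by [].
  have x1 : x < 1 by near: x; exact: nbhs_right_lt.
  rewrite /q gt_eqF// divr_ge0 ?(ltW x0)//.
  have x01 : x \in `[0, 1] by rewrite in_itv/= !ltW.
  by have := rho01 _ x01; rewrite in_itv/= => /andP[].
have q0 : q rho 0 = l.
  by rewrite /q eqxx (limf_esup_cvg ratio_l).
have qbar0 : qbar rho 0 = q rho 0.
  rewrite /qbar (_ : `[0, 0]%classic = [set 0]) ?image_set1 ?sup1//.
  by rewrite set_itv1.
rewrite qbar0 q0; split => //; last first.
  by rewrite ler_wpM2l//; case/andP: zeta01.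
have [eps0 eps0_gt0 lam_eps0] := limn_einf_gt lam_liminf.
have lam_K : \forall n \near \oo, (lam n)%:R / n%:R <= K.
  have [L1|L1] := pselect (limn_esup (fun n => ((lam n)%:R / n%:R : R)%:E) < 1)%E.
    have := limn_esup_lt (K_gt L1); apply: filterS => n.
    by rewrite lte_fin => /ltW.
  rewrite (K_eq1 L1); near=> n.
  have n_gt0 : (0 < n)%N by near: n; exact: nbhs_infty_gt.
  rewrite ler_pdivrMr ?ltr0n// mul1r ler_nat.
  by have /andP[] := lam_range _ n_gt0.
apply: (FDR_limit rho_cvf lam_range phi_sud eps0_gt0 _ hD3 hI1 hI2 zeta_lim
  lam_K gap ratio_l).
  by apply: filterS lam_eps0 => n; rewrite lte_fin => /ltW.
by rewrite l0 (le_trans l_alpha) ?ltW.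
Unshelve. all: end_near.
Qed.
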